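(* Let $p$ be a prime and $(G,\theta)$ a $p$-oriented profinite group. Then $(G,\theta)$ satisfies formal Hilbert 90 if and only if it admits a Hilbert 90 module.
   Context: A $p$-oriented profinite group is a pair $(G,\theta)$ with $G$ a profinite group and $\theta\colon G\to\mathbb Z_p^\times$ a continuous homomorphism. For $n\geq 1$, $\mathbb Z/p^n\mathbb Z(1)$ denotes the discrete $G$-module $\mathbb Z/p^n\mathbb Z$ with $g\cdot v=\theta(g)v$. $(G,\theta)$ satisfies formal Hilbert 90 if for every open subgroup $H\subset G$ and every $n\geq1$ the reduction map $H^1(H,\mathbb Z/p^n\mathbb Z(1))\to H^1(H,\mathbb Z/p\mathbb Z(1))$ is surjective. Let $S$ be the discrete $G$-module with underlying group $\mathbb Q/\mathbb Z_{(p)}$ on which $g\in G$ acts by multiplication by $\theta(g)$. A Hilbert 90 module for $(G,\theta)$ is a discrete $G$-module $M$ such that (i) $pM=M$, (ii) the $p$-primary torsion subgroup $M\{p\}$ is isomorphic to $S$ as a $G$-module, and (iii) $H^1(H,M)=0$ for every open subgroup $H\subset G$. *)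

(* Defs.v *)
From HB Require Import structures.
From mathcomp Require Import all_boot all_order all_algebra.
From mathcomp Require Import all_classical all_reals topology.
Set Implicit Arguments. Unset Strict Implicit. Unset Printing Implicit Defensive.
Import Order.TTheory GRing.Theory Num.Theory.
Local Open Scope classical_set_scope.
Local Open Scope ring_scope.

Section Defs.
Variable G : topologicalType.
Variables (mul : G -> G -> G) (one : G) (inv : G -> G).

Definition is_profinite_group : Prop :=
  [/\ (forall x y z, mul x (mul y z) = mul (mul x y) z),
      (forall x, mul one x = x /\ mul x one = x),
      (forall x, mul (inv x) x = one /\ mul x (inv x) = one),
      (continuous (fun xy : G * G => mul xy.1 xy.2) /\ continuous inv) &
      [/\ compact [set: G], hausdorff_space G & totally_disconnected [set: G]]].

Definition open_subgroup (H : set G) : Prop :=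
  [/\ open H, H one, (forall x y, H x -> H y -> H (mul x y)) &
      (forall x, H x -> H (inv x))].

(* A p-orientation theta : G -> Z_p^x, with Z_p = lim_n Z/p^n Z (inverse-limit
   topology). theta n g is the residue of theta(g) modulo p^n, represented in
   [0, p^n). *)
Definition is_p_orientation (p : nat) (theta : nat -> G -> nat) : Prop :=
  [/\ (forall n g, (theta n g < p ^ n)%N),
      (forall n g, theta n g = theta n.+1 g %% p ^ n)%N,
      (forall n g h, theta n (mul g h) = (theta n g * theta n h) %% p ^ n)%N,
      (forall n, theta n one = 1 %% p ^ n)%N &
      (forall g, coprime (theta 1 g) p) /\
      (forall n g, \forall x \near g, theta n x = theta n g)].

Section Modules.
Variables (M : zmodType) (act : G -> M -> M).

Definition discrete_module : Prop :=
  [/\ (forall g, {morph act g : x y / x + y}),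
      (forall m, act one m = m),
      (forall g h m, act (mul g h) m = act g (act h m)) &
      (forall m g, \forall x \near g, act x m = act g m)].

Definition cocycle (H : set G) (c : G -> M) : Prop :=
  (forall g h, H g -> H h -> c (mul g h) = c g + act g (c h)) /\
  (forall g, H g -> \forall x \near g, c x = c g).

Definition coboundary (H : set G) (c : G -> M) : Prop :=
  exists m, forall g, H g -> c g = act g m - m.

Definition H1_trivial (H : set G) : Prop :=
  forall c, cocycle H c -> coboundary H c.
End Modules.

Definition Zmu (p : nat) (theta : nat -> G -> nat) (n : nat)
  : G -> 'Z_(p ^ n) -> 'Z_(p ^ n) :=
  fun g v => (theta n g)%:R * v.

Definition red (p n : nat) (v : 'Z_(p ^ n)) : 'Z_p := (val v)%:R.

Definition formal_H90 (p : nat) (theta : nat -> G -> nat) : Prop :=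
  forall H, open_subgroup H -> forall n : nat, (1 <= n)%N ->
  forall c : G -> 'Z_p, cocycle (@Zmu p theta 1) H (fun g => c g) ->
  exists c' : G -> 'Z_(p ^ n), cocycle (@Zmu p theta n) H c' /\
    coboundary (@Zmu p theta 1) H (fun g => red (c' g) - c g).
End Defs.

(* The module S = Q / Z_(p), realized (via Q/Z_(p) ~= Z[1/p]/Z) as the
   rationals q in [0,1) whose denominator is a power of p. *)
Definition frac (q : rat) : rat := q - (Num.floor q)%:~R.
Definition S_set (p : nat) (q : rat) : Prop :=
  0 <= q < 1 /\ exists k, denq q = (p ^ k)%:Z.
Definition S_add (q1 q2 : rat) : rat := frac (q1 + q2).
(* action of g: multiplication by theta(g) in Z_p; on q = a/p^k only
   theta(g) mod p^k matters *)
Definition S_act (G : Type) (p : nat) (theta : nat -> G -> nat) (g : G) (q : rat)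
  : rat := frac ((theta (logn p `|denq q|%N) g)%:R * q).

Definition Hilbert90_module (G : topologicalType) (mul : G -> G -> G) (one : G)
  (inv : G -> G) (p : nat) (theta : nat -> G -> nat)
  (M : zmodType) (act : G -> M -> M) : Prop :=
  [/\ discrete_module mul one act,
      (forall m : M, exists m', m' *+ p = m),
      (exists f : rat -> M,
         [/\ (forall q, S_set p q -> exists k, f q *+ (p ^ k) = 0),
             (forall q1 q2, S_set p q1 -> S_set p q2 -> f q1 = f q2 -> q1 = q2),
             (forall m : M, (exists k, m *+ (p ^ k) = 0) ->
                 exists2 q, S_set p q & f q = m),
             (forall q1 q2, S_set p q1 -> S_set p q2 ->
                 f (S_add q1 q2) = f q1 + f q2) &
             (forall g q, S_set p q -> f (@S_act G p theta g q) = act g (f q))]) &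
      (forall H, open_subgroup mul one inv H -> H1_trivial mul act H)].

(* Main.v *)
Require Import Defs.
From HB Require Import structures.
From mathcomp Require Import all_boot all_order all_algebra.
From mathcomp Require Import all_classical all_reals topology.
Set Implicit Arguments. Unset Strict Implicit. Unset Printing Implicit Defensive.
Import Order.TTheory GRing.Theory Num.Theory.

(* Inside S the group Z/p^n(1) is the p^n-torsion S[p^n], so formal Hilbert 90
   says that p-torsion S-valued cocycles on open subgroups H are divisible by
   every p^n. If M is a Hilbert 90 module, such a cocycle is a coboundary of some
   m in M, and the coboundary of an m' with p^n m' = m takes values in M{p} = S.

   Conversely, by compactness cocycles H -> S have bounded exponent, so formal
   Hilbert 90 makes all of them p-divisible. Let I = C(G, S) be the coinduced
   module, J = I/S, and Q the discrete part of the limit of J under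
   multiplication by p. Then Q is uniquely divisible, Q^H -> J^H -> H^1(H, S) is
   onto, and M = I x_J Q, an extension of Q by S, is a Hilbert 90 module:
   H^1(H, M) is torsion by averaging, hence comes from H^1(H, S), where every
   class is a connecting image from Q^H. *)

(** * Profinite groups *)

Section ProfiniteGroup.
Local Open Scope classical_set_scope.
Local Open Scope ring_scope.
Variables (G : topologicalType) (mul : G -> G -> G) (one : G) (inv : G -> G).
Hypothesis profG : is_profinite_group mul one inv.
Local Infix "**" := mul (at level 40, left associativity).

Lemma pmulA x y z : x ** (y ** z) = x ** y ** z. Proof. by case: profG. Qed.
Lemma pmul1g x : one ** x = x. Proof. by case: profG => _ /(_ x)[]. Qed.
Lemma pmulg1 x : x ** one = x. Proof. by case: profG => _ /(_ x)[]. Qed.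
Lemma pmulVg x : inv x ** x = one. Proof. by case: profG => _ _ /(_ x)[]. Qed.
Lemma pmulgV x : x ** inv x = one. Proof. by case: profG => _ _ /(_ x)[]. Qed.
Lemma pmulKg x y : inv x ** (x ** y) = y.
Proof. by rewrite pmulA pmulVg pmul1g. Qed.
Lemma pmulKVg x y : x ** (inv x ** y) = y.
Proof. by rewrite pmulA pmulgV pmul1g. Qed.
Lemma pmulgK x y : y ** x ** inv x = y.
Proof. by rewrite -pmulA pmulgV pmulg1. Qed.
Lemma pinvK x : inv (inv x) = x.
Proof. by rewrite -[RHS](pmulKg (inv x)) pmulVg pmulg1. Qed.
Lemma pinv1 : inv one = one.
Proof. by rewrite -[LHS]pmul1g pmulgV. Qed.
Lemma pinvM x y : inv (x ** y) = inv y ** inv x.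
Proof. by rewrite -[RHS](pmulKg (x ** y)) !pmulA !pmulgK. Qed.

Lemma near_mulr g x (P : set G) :
  (\forall y \near x ** g, P y) -> \forall y \near x, P (y ** g).
Proof.
case: profG => _ _ _ [mulC _] _.
apply: (@continuous2_cvg _ _ _ _ _ _ id (fun=> g) mul) => //.
- exact: (mulC (x, g)).
- exact: cvg_cst.
Qed.

Lemma near_mull g x (P : set G) :
  (\forall y \near g ** x, P y) -> \forall y \near x, P (g ** y).
Proof.
case: profG => _ _ _ [mulC _] _.
apply: (@continuous2_cvg _ _ _ _ _ _ (fun=> g) id mul) => //.
- exact: (mulC (g, x)).
- exact: cvg_cst.
Qed.

Section OpenSubgroup.
Variable H : set G.
Hypothesis openH : open_subgroup mul one inv H.

Lemma osg1 : H one. Proof. by case: openH. Qed.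
Lemma osgM x y : H x -> H y -> H (x ** y). Proof. by case: openH => _ _ + _; apply. Qed.
Lemma osgV x : H x -> H (inv x). Proof. by case: openH => _ _ _; apply. Qed.

Lemma osg_near1 : \forall x \near one, H x.
Proof. by case: openH => oH H1 _ _; exact: open_nbhs_nbhs. Qed.

Lemma osgMr x y : H y -> H (x ** y) <-> H x.
Proof.
move=> Hy; split=> [Hxy|Hx]; last exact: osgM.
by rewrite -(pmulgK y x); apply: osgM => //; exact: osgV.
Qed.

Lemma near_lcoset x : \forall y \near x, H (inv x ** y).
Proof. by apply: near_mull; rewrite pmulVg; exact: osg_near1. Qed.

Lemma near_osg x : H x -> \forall y \near x, H y.
Proof.
move=> Hx; near=> y; rewrite -(pmulKVg x y); apply: osgM => //.
by near: y; exact: near_lcoset.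
Unshelve. all: by end_near. Qed.

Lemma near_osgC x : ~ H x -> \forall y \near x, ~ H y.
Proof.
move=> nHx; near=> y => Hy; apply: nHx.
rewrite -(pinvK x); apply: osgV; apply/(osgMr _ Hy).
by near: y; exact: near_lcoset.
Unshelve. all: by end_near. Qed.

End OpenSubgroup.

(** Compactness is used in near-covering form, along the filter [F] of properties shared by all
    large enough finite lists: near each [x] the value of [f] lies in every list containing
    [f x]. *)
Lemma locally_constant_finite (T : eqType) (f : G -> T) :
  (forall x, \forall y \near x, f y = f x) -> exists s : seq T, forall x, f x \in s.
Proof.
move=> lcf; have [_ _ _ _ [cG _ _]] := profG.
pose F : set_system (seq T) :=
  [set Q | exists s0 : seq T, forall s : seq T, {subset s0 <= s} -> Q s].
have FF : Filter F.
  split; first by exists [::].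
  - move=> P Q [s Ps] [t Qt]; exists (s ++ t) => u stu; split.
      by apply: Ps => z zs; apply: stu; rewrite mem_cat zs.
    by apply: Qt => z zs; apply: stu; rewrite mem_cat zs orbT.
  - by move=> P Q PQ [s Ps]; exists s => t /Ps/PQ.
have /compact_near_coveringP/(_ _ F (fun s x => f x \in s) FF) cov := cG.
case: cov => [x _|s covs].
  exists ([set y | f y = f x], [set s | f x \in s]); first split.
  - exact: lcf.
  - by exists [:: f x] => s; apply; rewrite mem_head.
  - by move=> [y s] /= [-> ].
by exists s => x; apply: (covs s).
Qed.

Lemma open_subgroupI (H K : set G) : open_subgroup mul one inv H ->
  open_subgroup mul one inv K -> open_subgroup mul one inv (H `&` K).
Proof.
move=> [oH H1 HM HV] [oK K1 KM KV]; split.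
- exact: openI.
- by split.
- by move=> x y [Hx Kx] [Hy Ky]; split; [apply: HM|apply: KM].
- by move=> x [Hx Kx]; split; [apply: HV|apply: KV].
Qed.

Lemma open_subgroupT : open_subgroup mul one inv setT.
Proof. by split=> //; exact: openT. Qed.

Lemma open_subgroupJ (H : set G) g : open_subgroup mul one inv H ->
  open_subgroup mul one inv [set x | H (inv g ** x ** g)].
Proof.
move=> oH; split => /=.
- rewrite openE => x /= Hx; rewrite /interior /=.
  apply: (@near_mull (inv g) x (fun y => H (y ** g))).
  by apply: (@near_mulr g); exact: near_osg.
- by rewrite pmulg1 pmulVg; exact: osg1.
- move=> x y Hx Hy; have := osgM oH Hx Hy.
  by rewrite !pmulA pmulgK.
- move=> x /(osgV oH) Hx.
  by move: Hx; rewrite !pinvM pinvK pmulA.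
Qed.

End ProfiniteGroup.

(** * Subgroups cut out by Prop-valued predicates *)

Section ZmodSubtype.
Local Open Scope ring_scope.
Local Open Scope classical_set_scope.

(** The closure proofs are bundled with the predicate so that the group structure on [zmod_sub P]
    can be inferred from [P] alone. *)
Record zmod_predicate (V : zmodType) := ZmodPredicate {
  zmod_pred :> V -> Prop;
  zmod_pred0 : zmod_pred 0;
  zmod_predB : forall x y, zmod_pred x -> zmod_pred y -> zmod_pred (x - y) }.

Definition zmod_sub (V : zmodType) (P : zmod_predicate V) : Type :=
  {x : V | `[< P x >]}.

Variables (V : zmodType) (P : zmod_predicate V).

Lemma zmod_sub_closed : zmod_closed (fun x : V => `[< P x >]).
Proof.
split; first exact/asboolP/zmod_pred0.
by move=> x y /asboolP Px /asboolP Py; exact/asboolP/zmod_predB.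
Qed.

HB.instance Definition _ := SubChoice.on (zmod_sub P).
HB.instance Definition _ :=
  GRing.SubChoice_isSubZmodule.Build V (fun x : V => `[< P x >]) (zmod_sub P)
    zmod_sub_closed.

Lemma zmod_subP (x : zmod_sub P) : P (val x).
Proof. by have /asboolP := valP x. Qed.

Definition to_zmod_sub (x : V) (Px : P x) : zmod_sub P := Sub x (asboolT Px).

End ZmodSubtype.

(** * Discrete modules and cocycles *)

Section DiscreteModule.
Local Open Scope classical_set_scope.
Local Open Scope ring_scope.
Variables (G : topologicalType) (mul : G -> G -> G) (one : G) (inv : G -> G).
Hypothesis profG : is_profinite_group mul one inv.
Local Infix "**" := mul (at level 40, left associativity).
Variables (M : zmodType) (act : G -> M -> M).
Hypothesis actP : discrete_module mul one act.

Lemma actD g x y : act g (x + y) = act g x + act g y.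
Proof. by case: actP => ->. Qed.
Lemma act1 x : act one x = x. Proof. by case: actP. Qed.
Lemma actM g h x : act (g ** h) x = act g (act h x). Proof. by case: actP. Qed.
Lemma near_act x g : \forall h \near g, act h x = act g x. Proof. by case: actP. Qed.

Lemma act0 g : act g 0 = 0.
Proof. by apply: (addIr (act g 0)); rewrite -actD !add0r. Qed.
Lemma actN g x : act g (- x) = - act g x.
Proof. by apply: (addIr (act g x)); rewrite -actD !addNr act0. Qed.
Lemma actB g x y : act g (x - y) = act g x - act g y.
Proof. by rewrite actD actN. Qed.
Lemma actMn g x n : act g (x *+ n) = act g x *+ n.
Proof. by elim: n => [|n IHn]; rewrite ?mulr0n ?act0// !mulrS actD IHn. Qed.
Lemma actK g x : act (inv g) (act g x) = x.
Proof. by rewrite -actM (pmulVg profG) act1. Qed.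
Lemma act_sum g (s : seq M) : act g (\sum_(x <- s) x) = \sum_(x <- s) act g x.
Proof. by elim: s => [|x s IHs]; rewrite ?big_nil ?act0// !big_cons actD IHs. Qed.

Variable H : set G.
Hypothesis openH : open_subgroup mul one inv H.

Lemma cocycle1 (c : G -> M) : cocycle mul act H c -> c one = 0.
Proof.
move=> [/(_ one one (osg1 openH) (osg1 openH)) + _].
by rewrite (pmul1g profG) act1 -{1}[c one]addr0 => /addrI ->.
Qed.

Lemma cocycle0 : cocycle mul act H (fun=> 0).
Proof. by split=> [g h _ _|g _]; [rewrite act0 addr0|exact: nearW]. Qed.

Lemma cocycleD (c d : G -> M) : cocycle mul act H c -> cocycle mul act H d ->
  cocycle mul act H (fun g => c g + d g).
Proof.
move=> [cM lc] [dM ld]; split=> [g h Hg Hh|g Hg].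
  by rewrite cM// dM// actD addrACA.
by near=> x; congr +%R; near: x; [exact: lc|exact: ld].
Unshelve. all: by end_near. Qed.

Lemma cocycleN (c : G -> M) : cocycle mul act H c ->
  cocycle mul act H (fun g => - c g).
Proof.
move=> [cM lc]; split=> [g h Hg Hh|g Hg]; first by rewrite cM// actN opprD.
by near=> x; congr -%R; near: x; exact: lc.
Unshelve. all: by end_near. Qed.

Lemma cocycleMn (c : G -> M) n : cocycle mul act H c ->
  cocycle mul act H (fun g => c g *+ n).
Proof.
move=> [cM lc]; split=> [g h Hg Hh|g Hg]; first by rewrite cM// actMn mulrnDl.
by near=> x; congr (_ *+ _); near: x; exact: lc.
Unshelve. all: by end_near. Qed.

Lemma cocycle_coboundary (m : M) : cocycle mul act H (fun g => act g m - m).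
Proof.
split=> [g h Hg Hh|g Hg]; first by rewrite actM actB [RHS]addrC subrKA.
by near=> x; congr (_ - _); near: x; exact: near_act.
Unshelve. all: by end_near. Qed.

Lemma cocycle_finite (c : G -> M) : cocycle mul act H c ->
  exists2 s : seq M, uniq s & forall v, v \in s <-> exists2 g, H g & c g = v.
Proof.
move=> [_ lc].
(* Nothing is known of [c] off [H], so [d] is [None] there; as [H] is closed as well as open, [d] is
   locally constant on all of [G]. *)
pose d g := if `[< H g >] then Some (c g) else None.
have [|s ds] := locally_constant_finite profG (f := d).
  move=> x; rewrite /d; case: (asboolP (H x)) => Hx.
    near=> y; rewrite asboolT; last by near: y; exact: (near_osg profG openH).
    by congr Some; near: y; exact: lc.
  near=> y; rewrite asboolF//; near: y; exact: (near_osgC profG openH).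
exists [seq v <- undup (pmap id s) | `[< exists2 g, H g & c g = v >]].
  by rewrite filter_uniq// undup_uniq.
move=> v; rewrite mem_filter mem_undup mem_pmap; split; first by case/andP => /asboolP.
move=> vc; rewrite asboolT//=; case: vc => g Hg <-.
by have := ds g; rewrite /d asboolT// map_id.
Unshelve. all: by end_near. Qed.

(* The values of a cocycle [c] form a finite set stable under the affine maps
   [m |-> g m + c g]; minus its barycentre trivialises [c]. *)
Lemma cocycle_averaging (c : G -> M) : cocycle mul act H c ->
  exists (N : nat) (m : M), (0 < N)%N /\
    forall g, H g -> c g *+ N = m - act g m.
Proof.
move=> cc; have [s us sP] := cocycle_finite cc.
exists (size s), (\sum_(x <- s) x); split.
  suff : 0 \in s by case: s {us sP}.
  by apply/sP; exists one; [exact: osg1 openH|exact: cocycle1].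
move=> g Hg; apply/eqP; rewrite eq_sym subr_eq; apply/eqP.
pose phi v := c g + act g v.
have phi_inj : injective phi by move=> x y /addrI/(congr1 (act (inv g))); rewrite !actK.
have eq_s : perm_eq s (map phi s).
  have sub : {subset map phi s <= s}.
    move=> _ /mapP[v /sP[h Hh <-] ->]; apply/sP; exists (g ** h).
      exact: (osgM openH).
    by case: cc => ->.
  rewrite perm_sym uniq_perm ?map_inj_uniq//.
  by apply: (uniq_min_size _ sub _).2; rewrite ?map_inj_uniq ?size_map.
transitivity (\sum_(x <- map phi s) x); first exact: perm_big.
rewrite big_map big_split/= act_sum; congr (_ + _).
by rewrite big_const_seq count_predT iter_addr_0.
Qed.

End DiscreteModule.

(** * The Hilbert 90 module *)

Section PrimaryDivisible.
Local Open Scope ring_scope.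
Variables (S : zmodType) (p : nat).
Hypothesis p_pr : prime p.
Hypothesis torS : forall s : S, exists k, s *+ (p ^ k) = 0.
Hypothesis divS : forall s : S, exists s', s' *+ p = s.

Lemma div_expn n (s : S) : exists s', s' *+ (p ^ n) = s.
Proof.
elim: n s => [|n IHn] s; first by exists s; rewrite expn0.
have [s1 <-] := divS s; have [s2 <-] := IHn s1.
by exists s2; rewrite expnSr mulrnA.
Qed.

Lemma tors_seq (s : seq S) : exists n, forall v, v \in s -> v *+ (p ^ n) = 0.
Proof.
elim: s => [|x s [n IHn]]; first by exists 0%N.
have [k xk] := torS x; exists (n + k)%N => v; rewrite inE => /orP[/eqP->|/IHn vn].
  by rewrite addnC expnD mulrnA xk mul0rn.
by rewrite expnD mulrnA vn mul0rn.
Qed.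

(** Some [p ^ k] kills [s], and [u] is an inverse of [N] modulo that power; hence [u] depends on
    [s]. *)
Lemma coprime_bezout N (s : S) : coprime N p -> exists u, s *+ N *+ u = s.
Proof.
move=> coNp; have [k sk] := torS s.
have N0 : (0 < N)%N.
  by case: N coNp => //; rewrite /coprime gcd0n => /eqP p1; move: p_pr; rewrite p1.
have /(coprimeP _ N0)[[u v] /= uv] : coprime N (p ^ k) by rewrite coprimeXr.
exists u; have uE : (N * u = v * p ^ k + 1)%N.
  by rewrite mulnC -uv subnKC// ltnW// -subn_gt0 uv.
by rewrite -mulrnA uE mulrnDr mulnC mulrnA sk mul0rn add0r.
Qed.

Lemma coprime_mulrn_inj N : coprime N p -> injective (fun s : S => s *+ N).
Proof.
move=> coNp x y /eqP; rewrite -subr_eq0 -mulrnBl => /eqP xy; apply/eqP.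
by rewrite -subr_eq0; have [u <-] := coprime_bezout (x - y) coNp; rewrite xy mul0rn.
Qed.

Lemma coprime_div N : coprime N p -> exists D : S -> S, forall s, D s *+ N = s.
Proof.
move=> coNp; suff /choice[D DP] : forall s : S, exists s', s' *+ N = s by exists D.
by move=> s; have [u us] := coprime_bezout s coNp; exists (s *+ u); rewrite mulrnAC.
Qed.

Section Cocycles.
Local Open Scope classical_set_scope.
Variables (G : topologicalType) (mul : G -> G -> G) (one : G) (inv : G -> G).
Hypothesis profG : is_profinite_group mul one inv.
Local Infix "**" := mul (at level 40, left associativity).
Variable act : G -> S -> S.
Hypothesis actP : discrete_module mul one act.

(* Formal Hilbert 90 inside [S]: identifying [Z/p^n(1)] with [S[p^n]], reduction
   mod [p] becomes multiplication by [p^(n-1)]; since [S] is [p]-divisible, the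
   lift can be made exact on cocycles rather than on classes. *)
Definition torsion_cocycles_divisible := forall H, open_subgroup mul one inv H ->
  forall (n : nat) (c : G -> S), cocycle mul act H c ->
  (forall g, H g -> c g *+ p = 0) ->
  exists2 d, cocycle mul act H d & forall g, H g -> d g *+ (p ^ n) = c g.

Hypothesis divcoc : torsion_cocycles_divisible.

(** A cocycle has finitely many values, so some p^n kills it, and one inducts on n. If p^(n+1) c =
    0, then p^n c is p-torsion, hence equals p^(n+1) d1; the difference c - p d1 is killed by p^n,
    so it is p d2, and d1 + d2 divides c. *)
Lemma cocycle_div H c : open_subgroup mul one inv H -> cocycle mul act H c ->
  exists2 d, cocycle mul act H d & forall g, H g -> d g *+ p = c g.
Proof.
move=> oH cc; have [s _ sP] := cocycle_finite profG oH cc.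
have [n sn] := tors_seq s.
have : forall g, H g -> c g *+ (p ^ n) = 0 by move=> g Hg; apply/sn/sP; exists g.
move: {s sP sn} cc; elim: n c => [|n IHn] c cc cn.
  exists (fun=> 0); first exact: (cocycle0 actP).
  by move=> g /cn; rewrite expn0 mulr1n mul0rn.
have [||d1 cd1 d1P] := @divcoc H oH n.+1 (fun g => c g *+ (p ^ n)).
- exact: (cocycleMn actP).
- by move=> g Hg; rewrite -mulrnA -expnSr; exact: cn.
have [||d2 cd2 d2P] := IHn (fun g => c g + - (d1 g *+ p)).
- apply: (cocycleD actP) => //; apply: (cocycleN actP); exact: (cocycleMn actP).
- by move=> g Hg; rewrite mulrnDl mulNrn -mulrnA -expnS d1P// subrr.
exists (fun g => d1 g + d2 g); first exact: (cocycleD actP).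
by move=> g Hg; rewrite mulrnDl d2P// addrC subrK.
Qed.

(** Dependent choice lifts [c] to the limit under multiplication by p, as the second coordinates of
    [H90_pred] require. *)
Lemma cocycle_div_seq H c : open_subgroup mul one inv H -> cocycle mul act H c ->
  exists e : nat -> G -> S, [/\ e 0%N = c,
    forall n g, H g -> e n.+1 g *+ p = e n g & forall n, cocycle mul act H (e n)].
Proof.
move=> oH cc.
pose X := {d : G -> S | cocycle mul act H d}.
pose R (d e : X) := forall g, H g -> sval e g *+ p = sval d g.
have [|e [e0 eS]] := @dependent_choice X R _ (exist _ c cc).
  move=> [d cd]; apply: cid; have [e ce eP] := cocycle_div oH cd.
  by exists (exist _ e ce).
exists (fun n => sval (e n)); split; first by rewrite e0.
- by move=> n g Hg; exact: eS.
- by move=> n; exact: (svalP (e n)).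
Qed.

(** The last clause says that [U] fixes the second coordinate under [H90_act_fun]. One [U] serves
    all [n], which selects the discrete part of the limit; at [x = u = one] the clause also forces
    the normalisation at [one]. *)
Definition H90_pred (v : S * (nat -> G -> S)) : Prop :=
  [/\ forall n x, v.2 n.+1 x *+ p = v.2 n x,
      forall n x, \forall y \near x, v.2 n y = v.2 n x &
      exists2 U, open_subgroup mul one inv U &
        forall n x u, U u -> v.2 n (x ** u) = v.2 n x + act x (v.2 n u)].

Lemma H90_pred0 : H90_pred 0.
Proof.
split=> [n x|n x|]; [exact: mul0rn|exact: nearW|].
exists setT; first exact: open_subgroupT.
by move=> n x u _ /=; rewrite (act0 actP) addr0.
Qed.

Lemma H90_predB v w : H90_pred v -> H90_pred w -> H90_pred (v - w).
Proof.
move=> [vp lv [U oU vU]] [wp lw [W oW wW]]; split=> [n x|n x|].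
- by rewrite -[RHS]/(v.2 n x - w.2 n x) -vp -wp -mulrnBl.
- near=> y; rewrite -[LHS]/(v.2 n y - w.2 n y) -[RHS]/(v.2 n x - w.2 n x).
  by congr (_ - _); near: y; [exact: lv|exact: lw].
exists (U `&` W); first exact: open_subgroupI.
move=> n x u [Uu Wu]; rewrite -[LHS]/(v.2 n (x ** u) - w.2 n (x ** u)).
rewrite -[RHS]/(v.2 n x - w.2 n x + act x (v.2 n u - w.2 n u)) vU// wW//.
by rewrite (actB actP) opprD addrACA.
Unshelve. all: by end_near. Qed.

Definition H90_zmod := zmod_sub (ZmodPredicate H90_pred0 H90_predB).

(* Pairs [(s, a)] stand for [(x |-> a 0 x + x s, a)] in the fibre product of the
   coinduced module [C(G, S)] with [lim_p (C(G, S) / S)], where a class in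
   [C(G, S) / S] is represented by the function vanishing at [one]; the [x]-term
   in the second component restores this normalisation. *)
Definition H90_act_fun g (v : S * (nat -> G -> S)) : S * (nat -> G -> S) :=
  (act g v.1 + v.2 0%N g, fun n x => v.2 n (x ** g) - act x (v.2 n g)).

Lemma H90_act_pred g v : H90_pred v -> H90_pred (H90_act_fun g v).
Proof.
move=> [vp lv [U oU vU]]; split=> [n x|n x|] /=.
- by rewrite mulrnBl -(actMn actP) !vp.
- near=> y; congr (_ - _); near: y; last exact: (near_act actP).
  exact: (near_mulr profG (P := fun z => v.2 n z = v.2 n (x ** g))).
(* If U fixes an element, the conjugate g U g^-1 fixes its translate by g. *)
exists [set x | U (inv g ** x ** g)]; first exact: (open_subgroupJ profG).
move=> n x u /= Uu.
have E y : v.2 n (y ** u ** g) = v.2 n (y ** g) + act (y ** g) (v.2 n (inv g ** u ** g)).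
  by rewrite -vU// !(pmulA profG) (pmulgK profG).
have := E one; rewrite !(pmul1g profG) => ->.
rewrite E (actB actP) (actD actP) -!(actM actP) [RHS]addrA [in RHS]addrA subrK.
by rewrite -!addrA.
Unshelve. all: by end_near. Qed.

Definition H90_act g (m : H90_zmod) : H90_zmod :=
  to_zmod_sub (P := ZmodPredicate H90_pred0 H90_predB) (H90_act_pred g (zmod_subP m)).

Lemma H90_act1 g m : (val (H90_act g m)).1 = act g (val m).1 + (val m).2 0%N g.
Proof. by []. Qed.

Lemma H90_act2 g m n x :
  (val (H90_act g m)).2 n x = (val m).2 n (x ** g) - act x ((val m).2 n g).
Proof. by []. Qed.

Lemma H90_eq (m m' : H90_zmod) : (val m).1 = (val m').1 ->
  (forall n x, (val m).2 n x = (val m').2 n x) -> m = m'.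
Proof.
move=> E1 E2; apply: val_inj; case: (val m) (val m') E1 E2 => [s a] [t b] /= -> ab.
by congr pair; apply/funext => n; apply/funext => x.
Qed.

Lemma H90_val1D (m m' : H90_zmod) : (val (m + m')).1 = (val m).1 + (val m').1.
Proof. by rewrite raddfD. Qed.

Lemma H90_val2D (m m' : H90_zmod) n x :
  (val (m + m')).2 n x = (val m).2 n x + (val m').2 n x.
Proof. by rewrite raddfD. Qed.

Lemma H90_val1B (m m' : H90_zmod) : (val (m - m')).1 = (val m).1 - (val m').1.
Proof. by rewrite raddfB. Qed.

Lemma H90_val2B (m m' : H90_zmod) n x :
  (val (m - m')).2 n x = (val m).2 n x - (val m').2 n x.
Proof. by rewrite raddfB. Qed.

Lemma H90_val1Mn (m : H90_zmod) k : (val (m *+ k)).1 = (val m).1 *+ k.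
Proof.
elim: k => [|k IHk]; first by rewrite !mulr0n raddf0.
by rewrite !mulrS H90_val1D IHk.
Qed.

Lemma H90_val2Mn (m : H90_zmod) k n x : (val (m *+ k)).2 n x = (val m).2 n x *+ k.
Proof.
elim: k => [|k IHk]; first by rewrite !mulr0n raddf0.
by rewrite !mulrS H90_val2D IHk.
Qed.

Lemma H90_val2_1 (m : H90_zmod) n : (val m).2 n one = 0.
Proof.
have [_ _ [U oU mU]] := zmod_subP m.
have := mU n one one (osg1 oU).
by rewrite (pmul1g profG) (act1 actP) -{1}[(val m).2 n one]addr0 => /addrI ->.
Qed.

Lemma H90_val2_exp (m : H90_zmod) n k x :
  (val m).2 (n + k)%N x *+ (p ^ k) = (val m).2 n x.
Proof.
have [mp _ _] := zmod_subP m.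
elim: k => [|k IHk]; first by rewrite addn0.
by rewrite -IHk addnS expnS mulrnA mp.
Qed.

Lemma H90_act_discrete : discrete_module mul one H90_act.
Proof.
split.
- move=> g m m'; apply: H90_eq => [|n x].
    by rewrite H90_val1D !H90_act1 H90_val1D H90_val2D (actD actP) addrACA.
  by rewrite H90_val2D !H90_act2 !H90_val2D (actD actP) opprD addrACA.
- move=> m; apply: H90_eq => [|n x] /=.
    by rewrite (act1 actP) H90_val2_1 addr0.
  by rewrite (pmulg1 profG) H90_val2_1 (act0 actP) subr0.
- move=> g h m; apply: H90_eq => [|n x] /=.
    by rewrite (actM actP) (actD actP) -addrA [act g _ + (_ - _)]addrC subrK.
  rewrite (pmulA profG) (actB actP) -!(actM actP) opprB.
  by rewrite addrA subrK.
- move=> m g.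
  have [_ lm [U oU mU]] := zmod_subP m.
  (* For [h] near [g], [inv g ** h] lies in [U], so [h] and [g] act alike on the second coordinate
     for all [n] at once. *)
  near=> h.
  have hE : h = g ** (inv g ** h) by rewrite (pmulKVg profG).
  have Uh : U (inv g ** h) by near: h; exact: (near_lcoset profG).
  have Eh n : act g ((val m).2 n (inv g ** h)) = (val m).2 n h - (val m).2 n g.
    by have := mU n g _ Uh; rewrite -hE => ->; rewrite addrC addKr.
  apply: H90_eq => [|n x] /=.
    by congr (_ + _); near: h; [exact: (near_act actP)|exact: lm].
  have -> : (val m).2 n (x ** h) =
      (val m).2 n (x ** g) + act (x ** g) ((val m).2 n (inv g ** h)).
    by rewrite -mU// -(pmulA profG) -hE.
  by rewrite (actM actP) Eh (actB actP) addrA addrAC addrK.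
Unshelve. all: by end_near. Qed.

Definition H90_incl_fun (s : S) : S * (nat -> G -> S) := (s, fun _ _ => 0).

Lemma H90_incl_pred s : H90_pred (H90_incl_fun s).
Proof.
split=> [n x|n x|] /=; [exact: mul0rn|exact: nearW|].
exists setT; first exact: open_subgroupT.
by move=> n x u _ /=; rewrite (act0 actP) addr0.
Qed.

Definition H90_incl s : H90_zmod :=
  to_zmod_sub (P := ZmodPredicate H90_pred0 H90_predB) (H90_incl_pred s).

Lemma H90_inclD s t : H90_incl (s + t) = H90_incl s + H90_incl t.
Proof. by apply: H90_eq => [|n x]; rewrite ?H90_val1D ?H90_val2D//= addr0. Qed.

Lemma H90_incl_act g s : H90_incl (act g s) = H90_act g (H90_incl s).
Proof. by apply: H90_eq => [|n x] /=; rewrite ?(act0 actP) ?subr0 ?addr0. Qed.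

Lemma H90_incl_inj : injective H90_incl.
Proof. by move=> s t /(congr1 (fun m => (val m).1)). Qed.

(** The second coordinates form a torsion-free group. Write N = N' p^k with N' prime to p: N kills
    a_(n+k), so N' kills p^k a_(n+k) = a_n, and N' acts injectively on [S]. *)
Lemma H90_torsion (m : H90_zmod) N : (0 < N)%N -> m *+ N = 0 ->
  m = H90_incl (val m).1.
Proof.
move=> N0 mN; apply: H90_eq => [//|n x /=].
have [N' coN' NE] := pfactor_coprime p_pr N0.
rewrite coprime_sym in coN'; apply: (coprime_mulrn_inj coN'); rewrite mul0rn.
rewrite -(H90_val2_exp m n (logn p N)) -mulrnA mulnC -NE -H90_val2Mn mN.
by rewrite raddf0.
Qed.

Lemma H90_divp (m : H90_zmod) : exists m', m' *+ p = m.
Proof.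
have [s sE] := divS (val m).1; have [mp lm [U oU mU]] := zmod_subP m.
(* Since p a_(n+1) = a_n, shifting the sequence divides it by p. *)
have P : H90_pred (s, fun n => (val m).2 n.+1).
  split=> [n x|n x|] /=; [exact: mp|exact: lm|].
  by exists U => // n x u Uu /=; exact: mU.
exists (to_zmod_sub (P := ZmodPredicate H90_pred0 H90_predB) P).
by apply: H90_eq => [|n x]; rewrite ?H90_val1Mn ?H90_val2Mn//=.
Qed.

(** Multiplication by N is bijective on [S], so its inverse [D] can be applied valuewise;
    injectivity transfers each clause of [H90_pred]. *)
Lemma H90_div_coprime N (m : H90_zmod) : coprime N p -> exists m', m' *+ N = m.
Proof.
move=> coN; have [D DP] := coprime_div coN; have injN := coprime_mulrn_inj coN.
have [mp lm [U oU mU]] := zmod_subP m.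
have P : H90_pred (D (val m).1, fun n x => D ((val m).2 n x)).
  split=> [n x|n x|] /=.
  - by apply: injN; rewrite mulrnAC !DP.
  - by near=> y; congr D; near: y; exact: lm.
  exists U => // n x u Uu /=; apply: injN.
  by rewrite mulrnDl -(actMn actP) !DP mU.
exists (to_zmod_sub (P := ZmodPredicate H90_pred0 H90_predB) P).
by apply: H90_eq => [|n x]; rewrite ?H90_val1Mn ?H90_val2Mn/= DP.
Unshelve. all: by end_near. Qed.

(** Arbitrary N must be allowed because the exponent produced by [cocycle_averaging] is a number of
    values, not a power of p. *)
Lemma H90_div N (m : H90_zmod) : (0 < N)%N -> exists m', m' *+ N = m.
Proof.
move=> N0; have [N' coN' ->] := pfactor_coprime p_pr N0.
rewrite coprime_sym in coN'; have [m1 <-] := H90_div_coprime m coN'.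
suff [m2 <-] : exists m2, m2 *+ (p ^ logn p N) = m1 by exists m2; rewrite mulnC mulrnA.
elim: (logn p N) m1 => [|k IHk] m1; first by exists m1; rewrite expn0.
have [m3 <-] := H90_divp m1; have [m4 <-] := IHk m3.
by exists m4; rewrite expnSr mulrnA.
Qed.

(** These represent the left cosets xH. The coset [H] itself is given [one], so that extending a
    cocycle along them does not change it on [H]. *)
Lemma coset_representatives H : open_subgroup mul one inv H ->
  exists r : G -> G, [/\ forall x, H (inv (r x) ** x),
    forall x h, H h -> r (x ** h) = r x & forall h, H h -> r h = one].
Proof.
move=> oH.
pose r x := if `[< H x >] then one else xget one [set y | H (inv y ** x)].
have rH h : H h -> r h = one by move=> Hh; rewrite /r asboolT.
exists r; split=> // [x|x h Hh].
  rewrite /r; case: asboolP => [Hx|_].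
    by apply: (osgM oH) => //; apply: (osgV oH); exact: (osg1 oH).
  case: xgetP => [y _ //|/(_ x)]; case => /=.
  by rewrite (pmulVg profG); exact: (osg1 oH).
have E (y : G) : H (y ** h) = H y by apply/propext; exact: (osgMr profG oH).
rewrite /r E; case: asboolP => // _; congr xget; apply/funext => y /=.
by rewrite (pmulA profG) E.
Qed.

(* Every class of [H^1(H, S)] dies in [H90_zmod]: extend a [p]-divisible
   sequence of cocycles from [H] to [G] along coset representatives. *)
Lemma H90_incl_coboundary H c : open_subgroup mul one inv H ->
  cocycle mul act H c -> coboundary H90_act H (fun g => H90_incl (c g)).
Proof.
move=> oH cc; have [e [e0 ep ce]] := cocycle_div_seq oH cc.
have [r [rx rM rH]] := coset_representatives oH.
(* This is the value forced by a(xh) = a(x) + x a(h) once a vanishes at the representatives. *)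
pose a n x := act (r x) (e n (inv (r x) ** x)).
have aM n x h : H h -> a n (x ** h) = a n x + act x (a n h).
  move=> Hh; rewrite /a rM// (rH h)// (act1 actP) (pinv1 profG) (pmul1g profG).
  rewrite (pmulA profG); have [-> //] := ce n.
  by rewrite (actD actP) -(actM actP) (pmulKVg profG).
have aH n h : H h -> a n h = e n h.
  by move=> Hh; rewrite /a (rH h)// (act1 actP) (pinv1 profG) (pmul1g profG).
have P : H90_pred (0, a).
  split=> [n x|n x|] /=.
  - by rewrite /a -(actMn actP) ep.
  - near=> y.
    have -> : y = x ** (inv x ** y) by rewrite (pmulKVg profG).
    rewrite /a rM; last by near: y; exact: (near_lcoset profG).
    rewrite (pmulKVg profG); congr act; near: y.
    apply: (near_mull profG (P := fun z => e n z = e n (inv (r x) ** x))).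
    by have [_] := ce n; apply.
  by exists H.
(* For g in [H], g fixes the second coordinate [a], so the coboundary of (0, a) at g is (a 0 g, 0),
   and [a 0 g] is [c g]. *)
exists (to_zmod_sub (P := ZmodPredicate H90_pred0 H90_predB) P) => g Hg.
apply: H90_eq => [|n x].
  by rewrite H90_val1B /= (act0 actP) add0r subr0 aH// e0.
rewrite H90_val2B /=.
by rewrite aM// addrK subrr.
Unshelve. all: by end_near. Qed.

(** Averaging makes N c the negative of the coboundary of m = N m'. Adding the coboundary of m' to c
    gives an N-torsion cocycle, which lies in [S] and is trivialised by [H90_incl_coboundary]. *)
Lemma H90_H1_trivial H : open_subgroup mul one inv H -> H1_trivial mul H90_act H.
Proof.
move=> oH c cc; have actMP := H90_act_discrete.
have [N [m [N0 mP]]] := cocycle_averaging profG actMP oH cc.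
have [m' m'E] := H90_div m N0.
pose d g := c g + (H90_act g m' - m').
have dc : cocycle mul H90_act H d.
  by apply: (cocycleD actMP) => //; exact: (cocycle_coboundary actMP).
have dN g : H g -> d g = H90_incl (val (d g)).1.
  move=> Hg; apply: (H90_torsion N0).
  by rewrite mulrnDl mP// mulrnBl -(actMn actMP) m'E addrA subrK subrr.
have sc : cocycle mul act H (fun g => (val (d g)).1).
  (* Projection to the first coordinate fails to be equivariant by the term [(val m).2 0 g], which
     vanishes on values in [S]. *)
  have [dM ld] := dc; split=> [g h Hg Hh|g Hg].
    have d0 : (val (d h)).2 0%N g = 0 by rewrite (dN h Hh).
    by rewrite (dM g h Hg Hh) H90_val1D H90_act1 d0 addr0.
  by apply: filterS (ld g Hg) => x ->.
have [m2 m2P] := H90_incl_coboundary oH sc.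
exists (m2 - m') => g Hg; apply: (addIr (H90_act g m' - m')).
rewrite -[LHS]/(d g) (dN g Hg) (m2P g Hg) (actB actMP).
by rewrite opprB [RHS]addrAC !subrKA.
Qed.

End Cocycles.
End PrimaryDivisible.

(** * The Prufer group *)

(* [frac] alone would denote the numerator-denominator pairs of fraction.v. *)
Local Notation frac := Defs.frac.

Section FractionalPart.
Local Open Scope ring_scope.
Implicit Types x y : rat.

Lemma frac_itv x : 0 <= frac x < 1.
Proof.
have /andP[lx xl] := floor_itv x.
by rewrite /frac subr_ge0 lx ltrBlDr addrC -intrD1.
Qed.

Lemma frac_id x : 0 <= x < 1 -> frac x = x.
Proof. by move=> x01; rewrite /frac (@floor_def _ x 0) ?subr0// add0r. Qed.

Lemma sub_frac_int x : x - frac x \is a Num.int.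
Proof. by rewrite /frac subKr intr_int. Qed.

Lemma eq_frac x y : x - y \is a Num.int -> frac x = frac y.
Proof.
move=> xy; rewrite -[x](subrK y) addrC /frac floorDrz// intrD.
by move: (xy); rewrite intrEfloor => /eqP ->; rewrite opprD addrACA subrr addr0.
Qed.

Lemma frac_eqE x y : frac x = frac y -> x - y \is a Num.int.
Proof.
move=> xy; have := rpredB (sub_frac_int x) (sub_frac_int y).
by rewrite xy; move: (frac y) => f; rewrite opprB subrKA.
Qed.

Lemma fracDl x y : frac (frac x + y) = frac (x + y).
Proof.
by apply: eq_frac; rewrite opprD addrACA subrr addr0 -opprB rpredN sub_frac_int.
Qed.

Lemma fracDr x y : frac (x + frac y) = frac (x + y).
Proof. by rewrite addrC fracDl addrC. Qed.

Lemma frac_natMr n x : frac (n%:R * frac x) = frac (n%:R * x).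
Proof.
apply: eq_frac; rewrite -mulrBr rpredM ?natr_int//.
by rewrite -opprB rpredN sub_frac_int.
Qed.

(** (m - n) x is an integer multiple of p^k x. This is why a residue modulo p^k suffices to act on
    [x]. *)
Lemma frac_mod p k m n x : m = n %[mod p ^ k] -> (p ^ k)%:R * x \is a Num.int ->
  frac (m%:R * x) = frac (n%:R * x).
Proof.
move=> mn px; apply: eq_frac; rewrite -mulrBl.
rewrite (divn_eq m (p ^ k)) (divn_eq n (p ^ k)) mn !natrD opprD addrACA subrr addr0.
by rewrite !natrM -mulrBl -mulrA rpredM// rpredB ?natr_int.
Qed.

Lemma dvdn_denq n x : n%:R * x \is a Num.int -> (`|denq x| %| n)%N.
Proof.
move=> /intrP[m E].
have : n%:Z * numq x = m * denq x.
  by apply/eqP; rewrite -(eqr_int rat) !intrM numqE -E mulrA.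
move=> /(congr1 absz); rewrite !abszM /= => E'.
have /Gauss_dvdl <- : coprime `|denq x| `|numq x| by rewrite coprime_sym coprime_num_den.
by rewrite E' dvdn_mull.
Qed.

Lemma denq_mul_int x : `|denq x|%:R * x \is a Num.int.
Proof. by rewrite pmulrn absz_denq mulrC -numqE intr_int. Qed.

End FractionalPart.

Section PruferGroup.
Local Open Scope ring_scope.

(** Unlike an equation on [denq], this form passes directly to sums and multiples; [S_setP] compares
    the two. *)
Definition p_power_den (p : nat) (x : rat) := exists k, (p ^ k)%:R * x \is a Num.int.

(** Canonical representatives in [0, 1) are kept so that, for prime p, the points are exactly those
    of [S_set p] and addition is [S_add]. *)
Definition prufer (p : nat) : Type :=
  {x : rat | `[< 0 <= x < 1 /\ p_power_den p x >]}.

HB.instance Definition _ p := SubChoice.on (prufer p).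

Variable p : nat.
Implicit Types x y : rat.

Lemma p_power_den_leq k l x : (k <= l)%N -> (p ^ k)%:R * x \is a Num.int ->
  (p ^ l)%:R * x \is a Num.int.
Proof.
move=> kl px; rewrite -(subnK kl) expnD natrM -mulrA.
by rewrite rpredM ?natr_int.
Qed.

Lemma p_power_denD x y : p_power_den p x -> p_power_den p y -> p_power_den p (x + y).
Proof.
move=> [k kx] [l ly]; exists (k + l)%N; rewrite mulrDr rpredD//.
  by apply: p_power_den_leq kx; rewrite leq_addr.
by apply: p_power_den_leq ly; rewrite leq_addl.
Qed.

Lemma p_power_denN x : p_power_den p x -> p_power_den p (- x).
Proof. by move=> [k kx]; exists k; rewrite mulrN rpredN. Qed.

Lemma p_power_den_natM n x : p_power_den p x -> p_power_den p (n%:R * x).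
Proof. by move=> [k kx]; exists k; rewrite mulrCA rpredM ?natr_int. Qed.

Lemma p_power_den_int x : x \is a Num.int -> p_power_den p x.
Proof. by move=> ix; exists 0%N; rewrite expn0 mul1r. Qed.

Lemma p_power_den_frac x : p_power_den p x -> p_power_den p (frac x).
Proof.
by move=> px; rewrite -[frac x](subKr x); apply: p_power_denD => //;
  exact/p_power_denN/p_power_den_int/sub_frac_int.
Qed.

Lemma p_power_den_div k m : p_power_den p (m%:R / (p ^ k)%:R).
Proof.
(* Here p may be 0, in which case a zero denominator makes the quotient 0 by convention. *)
exists k; have [->|pk0] := eqVneq ((p ^ k)%:R : rat) 0; first by rewrite mul0r rpred0.
by rewrite mulrC divfK ?natr_int.
Qed.

Definition prufer_frac x (px : p_power_den p x) : prufer p :=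
  Sub (frac x) (asboolT (conj (frac_itv x) (p_power_den_frac px))).

Lemma prufer_itv (s : prufer p) : 0 <= val s < 1.
Proof. by have /asboolP[] := valP s. Qed.

Lemma prufer_den (s : prufer p) : p_power_den p (val s).
Proof. by have /asboolP[] := valP s. Qed.

Definition prufer_add (s t : prufer p) :=
  prufer_frac (p_power_denD (prufer_den s) (prufer_den t)).
Definition prufer_opp (s : prufer p) := prufer_frac (p_power_denN (prufer_den s)).
Definition prufer_zero := prufer_frac (p_power_den_int (rpred0 _)).

Lemma prufer_addA : associative prufer_add.
Proof. by move=> s t u; apply: val_inj; rewrite /= fracDl fracDr addrA. Qed.

Lemma prufer_addC : commutative prufer_add.
Proof. by move=> s t; apply: val_inj; rewrite /= addrC. Qed.

Lemma prufer_add0 : left_id prufer_zero prufer_add.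
Proof. by move=> s; apply: val_inj; rewrite /= fracDl add0r frac_id ?prufer_itv. Qed.

Lemma prufer_addN : left_inverse prufer_zero prufer_opp prufer_add.
Proof. by move=> s; apply: val_inj; rewrite /= fracDl addNr. Qed.

HB.instance Definition _ := GRing.isZmodule.Build (prufer p)
  prufer_addA prufer_addC prufer_add0 prufer_addN.

Lemma val_pruferD (s t : prufer p) : val (s + t) = frac (val s + val t).
Proof. by []. Qed.

Lemma val_prufer0 : val (0 : prufer p) = 0.
Proof. exact: frac_id. Qed.

Lemma val_pruferMn (s : prufer p) n : val (s *+ n) = frac (n%:R * val s).
Proof.
elim: n => [|n IHn]; first by rewrite mulr0n val_prufer0 mul0r frac_id.
by rewrite mulrS val_pruferD IHn fracDr mulrS mulrDl mul1r.
Qed.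

Lemma prufer_torsion (s : prufer p) : exists k, s *+ (p ^ k) = 0.
Proof.
have [k ks] := prufer_den s; exists k; apply: val_inj.
rewrite val_pruferMn val_prufer0 -[RHS](@frac_id 0)//.
by apply: eq_frac; rewrite subr0.
Qed.

Lemma pruferMn_eq0 (s : prufer p) n : s *+ n = 0 -> n%:R * val s \is a Num.int.
Proof.
move=> /(congr1 val); rewrite val_pruferMn val_prufer0 -[RHS](@frac_id 0)//.
by move/frac_eqE; rewrite subr0.
Qed.

Hypothesis p_pr : prime p.

Lemma expp_neq0 k : (p ^ k)%:R != 0 :> rat.
Proof. by rewrite pnatr_eq0 -lt0n expn_gt0 prime_gt0. Qed.

Lemma prufer_divisible (s : prufer p) : exists s', s' *+ p = s.
Proof.
have P : p_power_den p (val s / p%:R).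
  have [k ks] := prufer_den s; exists k.+1.
  by rewrite expnSr natrM -mulrA [p%:R * _]mulrC divfK// (expp_neq0 1).
exists (prufer_frac P); apply: val_inj.
by rewrite val_pruferMn /= frac_natMr mulrC divfK ?(expp_neq0 1)// frac_id ?prufer_itv.
Qed.

Lemma S_setP q : S_set p q <-> 0 <= q < 1 /\ p_power_den p q.
Proof.
split=> [[q01 [k kq]]|[q01 [k /dvdn_denq/(dvdn_pfactor _ _ p_pr)[m _ mq]]]].
  by split=> //; exists k; have := denq_mul_int q; rewrite kq.
by split=> //; exists m; rewrite -mq absz_denq.
Qed.

Lemma S_set_val (s : prufer p) : S_set p (val s).
Proof. by apply/S_setP; split; [exact: prufer_itv|exact: prufer_den]. Qed.

Lemma S_set_ex q : S_set p q -> exists s : prufer p, val s = q.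
Proof. by move/S_setP => Sq; exists (Sub q (asboolT Sq)). Qed.

End PruferGroup.

(** * The oriented action on the Prufer group *)

Section OrientedAction.
Local Open Scope classical_set_scope.
Local Open Scope ring_scope.
Variables (p : nat) (G : topologicalType) (mul : G -> G -> G) (one : G).
Variables (inv : G -> G) (theta : nat -> G -> nat).
Hypothesis p_pr : prime p.
Hypothesis profG : is_profinite_group mul one inv.
Hypothesis thetaP : is_p_orientation mul one p theta.

Lemma theta_mod k l g : (k <= l)%N -> theta l g = theta k g %[mod p ^ k].
Proof.
case: thetaP => _ thS _ _ _ kl; rewrite -(subnK kl).
elim: (l - k)%N => [//|m IHm]; rewrite addSn -IHm (thS (m + k)%N) modn_dvdm//.
by rewrite dvdn_exp2l// leq_addl.
Qed.

(** [S_act] reads theta at the exact exponent of the denominator; freeing the exponent lets several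
    elements share one. *)
Lemma S_actE g q k : (p ^ k)%:R * q \is a Num.int ->
  S_act p theta g q = frac ((theta k g)%:R * q).
Proof.
move=> kq; have /(dvdn_pfactor _ _ p_pr)[m mk mq] := dvdn_denq kq.
rewrite /S_act mq pfactorK//; apply/esym/(@frac_mod p m); first exact: theta_mod.
by rewrite -mq denq_mul_int.
Qed.

Lemma prufer_act_den g (s : prufer p) : p_power_den p (S_act p theta g (val s)).
Proof. exact/p_power_den_frac/p_power_den_natM/prufer_den. Qed.

Definition prufer_act g (s : prufer p) : prufer p := prufer_frac (prufer_act_den g s).

Lemma val_prufer_act g s : val (prufer_act g s) = S_act p theta g (val s).
Proof. by rewrite /= frac_id// frac_itv. Qed.

Lemma val_prufer_actE g s k : (p ^ k)%:R * val s \is a Num.int ->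
  val (prufer_act g s) = frac ((theta k g)%:R * val s).
Proof. by move=> ks; rewrite val_prufer_act (S_actE _ ks). Qed.

Lemma frac_int k x : (p ^ k)%:R * x \is a Num.int ->
  (p ^ k)%:R * frac x \is a Num.int.
Proof.
move=> kx; rewrite -[frac x](subKr x) mulrBr rpredB//.
by rewrite rpredM ?natr_int ?sub_frac_int.
Qed.

Lemma prufer_act_discrete : discrete_module mul one prufer_act.
Proof.
case: (thetaP) => _ thS thM th1 [_ lth]; split.
- move=> g s t; apply: val_inj.
  have [[k ks] [l lt]] := (prufer_den s, prufer_den t).
  have {}ks := p_power_den_leq (leq_addr l k) ks.
  have {}lt := p_power_den_leq (leq_addl k l) lt.
  have kst : (p ^ (k + l))%:R * val (s + t) \is a Num.int.
    by rewrite val_pruferD; apply: frac_int; rewrite mulrDr rpredD.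
  have [Es Et] := (val_prufer_actE g ks, val_prufer_actE g lt).
  rewrite (val_prufer_actE _ kst) (val_pruferD s t) (val_pruferD (prufer_act g s)) Es Et.
  by rewrite fracDl fracDr frac_natMr mulrDr.
- move=> s; apply: val_inj; have [k ks] := prufer_den s.
  rewrite (val_prufer_actE _ ks) th1 -[RHS]frac_id ?prufer_itv// -[in RHS](mul1r (val s)).
  by apply: (@frac_mod p k _ 1%N) => //; rewrite modn_mod.
- move=> g h s; apply: val_inj; have [k ks] := prufer_den s.
  have khs : (p ^ k)%:R * val (prufer_act h s) \is a Num.int.
    rewrite (val_prufer_actE _ ks); apply: frac_int.
    by rewrite mulrCA rpredM ?natr_int.
  rewrite (val_prufer_actE _ ks) (val_prufer_actE _ khs) (val_prufer_actE _ ks).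
  rewrite frac_natMr mulrA -natrM.
  by apply: (@frac_mod p k) => //; rewrite thM modn_mod.
- move=> s g; have [k ks] := prufer_den s.
  apply: filterS (lth k g) => h E; apply: val_inj.
  by rewrite !(val_prufer_actE _ ks) E.
Qed.

(** * Z/p^n(1) as the p^n-torsion of the Prufer group *)

Section Zmod.
Variable n : nat.
Hypothesis n_gt0 : (0 < n)%N.

(** The type ['Z_1] has two elements, so ['Z_(p ^ n)] models Z/p^n only when p^n > 1. *)
Lemma expp_gt1 : (1 < p ^ n)%N.
Proof. by rewrite -(exp1n n) ltn_exp2r// prime_gt1. Qed.

Definition Z_prufer (v : 'Z_(p ^ n)) : prufer p :=
  prufer_frac (p_power_den_div p n (nat_of_ord v)).

(** Modulo Z, m/p^n depends only on m mod p^n, so any natural representative may be used in checking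
    additivity and equivariance. *)
Lemma Z_prufer_nat m : Z_prufer m%:R = prufer_frac (p_power_den_div p n m).
Proof.
apply: val_inj => /=; rewrite ![_ / _]mulrC !(mulrC _^-1).
have K : (p ^ n)%:R * (p ^ n)%:R^-1 \is a @Num.int rat.
  by rewrite divff ?rpred1// expp_neq0.
by apply: (@frac_mod p n) => //; rewrite val_Zp_nat ?expp_gt1// modn_mod.
Qed.

Lemma Z_pruferD v w : Z_prufer (v + w) = Z_prufer v + Z_prufer w.
Proof.
rewrite -[in LHS](natr_Zp v) -[in LHS](natr_Zp w) -natrD Z_prufer_nat.
by apply: val_inj; rewrite val_pruferD /= fracDl fracDr natrD mulrDl.
Qed.

Lemma Z_prufer_inj : injective Z_prufer.
Proof.
move=> v w /(congr1 val) /=; have lt1 (u : 'Z_(p ^ n)) : 0 <= (u%:R / (p ^ n)%:R : rat) < 1.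
  have p0 : 0 < (p ^ n)%:R :> rat by rewrite ltr0n expn_gt0 prime_gt0.
  rewrite divr_ge0 ?ler0n//= ltr_pdivrMr// mul1r ltr_nat.
  by have := ltn_ord u; rewrite [X in (_ < X)%N -> _]Zp_cast// expp_gt1.
rewrite !frac_id// => /(mulIf (invr_neq0 (expp_neq0 p_pr n)))/eqP.
by rewrite eqr_nat => /eqP/val_inj.
Qed.

Lemma Z_prufer_act g v : Z_prufer (Zmu theta g v) = prufer_act g (Z_prufer v).
Proof.
have K m : (p ^ n)%:R * (m%:R / (p ^ n)%:R) \is a @Num.int rat.
  by rewrite mulrC divfK ?natr_int// expp_neq0.
rewrite /Zmu -[in LHS](natr_Zp v) -natrM Z_prufer_nat; apply: val_inj.
rewrite (@val_prufer_actE _ _ n); last exact/frac_int/K.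
by rewrite /= frac_natMr natrM mulrA.
Qed.

Lemma Z_prufer_torsion v : Z_prufer v *+ (p ^ n) = 0.
Proof.
apply: val_inj; rewrite val_pruferMn val_prufer0 /= frac_natMr.
rewrite mulrC divfK ?expp_neq0// -[RHS](@frac_id 0)//.
by apply: eq_frac; rewrite subr0 natr_int.
Qed.

Lemma prufer_torsion_Z (s : prufer p) : s *+ (p ^ n) = 0 -> exists v, Z_prufer v = s.
Proof.
move=> /pruferMn_eq0 sn; have /andP[s0 s1] := prufer_itv s.
have /natrP[m mE] : (p ^ n)%:R * val s \is a Num.nat.
  by rewrite natrEint sn mulr_ge0 ?ler0n.
exists m%:R; rewrite Z_prufer_nat; apply: val_inj => /=.
by rewrite -mE [_ * val s]mulrC mulfK ?expp_neq0// frac_id// s0.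
Qed.

End Zmod.

(** Both sides are v/p modulo Z. The types ['Z_p] and ['Z_(p ^ 1)] are convertible. *)
Lemma Z_prufer_red n (v : 'Z_(p ^ n)) : (0 < n)%N ->
  Z_prufer (n := 1) (red v) = Z_prufer v *+ (p ^ n.-1).
Proof.
case: n v => // n v _; rewrite /red Z_prufer_nat//; apply: val_inj.
rewrite val_pruferMn /= frac_natMr; move: (nat_of_ord v) => m.
rewrite expn1 expnS natrM invfM.
by rewrite [X in _ = frac (_ * X)]mulrA [in RHS]mulrC divfK ?expp_neq0.
Qed.

Lemma formal_H90P : formal_H90 mul one inv p theta <->
  torsion_cocycles_divisible p mul one inv prufer_act.
Proof.
have actP := prufer_act_discrete.
split=> [H90 H oH n c [cM lc] cp|divc H oH n n1 c [cM lc]].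
- have /choice[c1 c1P] : forall g, exists v : 'Z_(p ^ 1), H g -> Z_prufer v = c g.
    move=> g; have [Hg|nHg] := pselect (H g); last by exists 0.
    by have [v vE] := prufer_torsion_Z (n := 1) isT (cp g Hg); exists v.
  have c1c : cocycle mul (@Zmu G p theta 1) H c1.
    split=> [g h Hg Hh|g Hg].
      apply: (@Z_prufer_inj 1 isT).
      by rewrite Z_pruferD// Z_prufer_act// !c1P ?cM//; exact: (osgM oH).
    apply: filterS2 (lc g Hg) (near_osg profG oH Hg) => x cx Hx.
    by apply: (@Z_prufer_inj 1 isT); rewrite !c1P.
  (* The level is n+1 because reduction from Z/p^(n+1) to Z/p is multiplication by p^n. *)
  have [c' [[c'M lc'] [m mP]]] := H90 H oH n.+1 isT c1 c1c.
  have [m' m'E] := div_expn (@prufer_divisible p p_pr) n (Z_prufer (n := 1) m).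
  pose d0 g := Z_prufer (n := n.+1) (c' g).
  have d0c : cocycle mul prufer_act H d0.
    split=> [g h Hg Hh|g Hg]; first by rewrite /d0 c'M// Z_pruferD// Z_prufer_act.
    by apply: filterS (lc' g Hg) => x; rewrite /d0 => ->.
  (* p^n d0 differs from c by the coboundary of m = p^n m'; removing that of m' makes the division
     exact. *)
  exists (fun g => d0 g + - (prufer_act g m' - m')).
    by apply: (cocycleD actP) => //; apply: (cocycleN actP); exact: (cocycle_coboundary actP).
  move=> g Hg; have := mP g Hg => /(congr1 (@Z_prufer 1)).
  have ZB v w : Z_prufer (n := 1) (v - w) = Z_prufer (n := 1) v - Z_prufer (n := 1) w.
    by apply/eqP; rewrite eq_sym subr_eq -Z_pruferD// subrK.
  rewrite !ZB Z_prufer_red// c1P// Z_prufer_act// -m'E => E.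
  rewrite mulrnDl mulNrn mulrnBl -(actMn actP) -E.
  by rewrite opprB addrC subrK.
- pose d0 g := Z_prufer (n := 1) (c g).
  have d0c : cocycle mul prufer_act H d0.
    split=> [g h Hg Hh|g Hg]; first by rewrite /d0 cM// Z_pruferD// Z_prufer_act.
    by apply: filterS (lc g Hg) => x; rewrite /d0 => ->.
  have [|d [dM ld] dP] := divc H oH n.-1 d0 d0c.
    by move=> g _; rewrite -[X in _ *+ X](expn1 p); exact: Z_prufer_torsion.
  have /choice[c' c'P] : forall g, exists v : 'Z_(p ^ n), H g -> Z_prufer v = d g.
    move=> g; have [Hg|nHg] := pselect (H g); last by exists 0.
    have [|v vE] := prufer_torsion_Z n1 (s := d g); last by exists v.
    (* p^(n-1) d is the given p-torsion cocycle, so p^n kills d and its values come from Z/p^n. *)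
    rewrite -(prednK n1) expnSr mulrnA dP// -[X in _ *+ X](expn1 p).
    exact: Z_prufer_torsion.
  exists c'; split.
    split=> [g h Hg Hh|g Hg].
      apply: (Z_prufer_inj n1).
      by rewrite Z_pruferD// Z_prufer_act// !c'P ?dM//; exact: (osgM oH).
    apply: filterS2 (ld g Hg) (near_osg profG oH Hg) => x dx Hx.
    by apply: (Z_prufer_inj n1); rewrite !c'P.
  (* The lift reduces to [c] exactly on [H], so the coboundary is that of 0. *)
  exists 0 => g Hg; rewrite /Zmu mulr0 subr0; apply/eqP; rewrite subr_eq0; apply/eqP.
  by apply: (@Z_prufer_inj 1 isT); rewrite Z_prufer_red// c'P// dP.
Qed.

Lemma H90_module_divisible (M : zmodType) (act : G -> M -> M) :
  Hilbert90_module mul one inv p theta act ->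
  torsion_cocycles_divisible p mul one inv prufer_act.
Proof.
move=> [actP divM [f [_ finj fsurj fD fact]] H1].
pose F (s : prufer p) : M := f (val s).
have FD s t : F (s + t) = F s + F t by apply: fD; exact: S_set_val.
have Finj : injective F by move=> s t /finj E; apply/val_inj/E; exact: S_set_val.
have Fact g s : F (prufer_act g s) = act g (F s).
  by rewrite /F val_prufer_act; apply: fact; exact: S_set_val.
have F0 : F 0 = 0 by apply: (addIr (F 0)); rewrite -FD !add0r.
have FMn s k : F (s *+ k) = F s *+ k.
  by elim: k => [|k IHk]; rewrite ?mulr0n// !mulrS FD IHk.
move=> H oH n c [cM lc] _.
have [|m mP] := H1 H oH (fun g => F (c g)).
  split=> [g h Hg Hh|g Hg]; first by rewrite cM// FD Fact.
  by apply: filterS (lc g Hg) => x ->.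
have [m' m'E] := div_expn divM n m.
have [eM le] := cocycle_coboundary actP H m'.
have eP g : H g -> (act g m' - m') *+ (p ^ n) = F (c g).
  by move=> Hg; rewrite mulrnBl -(actMn actP) m'E mP.
have /choice[d dP] : forall g, exists s, H g -> F s = act g m' - m'.
  move=> g; have [Hg|nHg] := pselect (H g); last by exists 0.
  have [k ck] := prufer_torsion (c g).
  have [|q Sq fq] := fsurj (act g m' - m').
    (* p^n sends the coboundary of m' to F (c g), which p^k kills; hence its value is p-primary
       torsion and lies in the image of [F]. *)
    by exists (n + k)%N; rewrite expnD mulrnA eP// -FMn ck.
  by have [s sq] := S_set_ex p_pr Sq; exists s => _; rewrite /F sq.
exists d.
  split=> [g h Hg Hh|g Hg].
    by apply: Finj; rewrite FD Fact !dP ?eM//; exact: (osgM oH).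
  apply: filterS2 (le g Hg) (near_osg profG oH Hg) => x ex Hx.
  by apply: Finj; rewrite !dP.
by move=> g Hg; apply: Finj; rewrite FMn dP// eP.
Qed.

End OrientedAction.

Theorem theorem1p5 (p : nat) (G : topologicalType)
  (mul : G -> G -> G) (one : G) (inv : G -> G) (theta : nat -> G -> nat) :
  prime p ->
  is_profinite_group mul one inv ->
  is_p_orientation mul one p theta ->
  (formal_H90 mul one inv p theta <->
   exists (M : zmodType) (act : G -> M -> M),
     Hilbert90_module mul one inv p theta act).
Proof.
move=> p_pr profG thetaP; rewrite (formal_H90P p_pr profG thetaP).
split=> [divc|[M [act]]]; last exact: (H90_module_divisible p_pr profG).
have actP := prufer_act_discrete p_pr thetaP.
have tors := @prufer_torsion p; have divS := prufer_divisible p_pr.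
exists (H90_zmod p inv actP), (H90_act profG (actP := actP)); split.
- exact: H90_act_discrete.
- exact: H90_divp.
(* The map must be defined on all rationals; [insubd] sends those outside [S_set p] to 0. *)
- exists (fun q => H90_incl p inv actP (insubd (0%R : prufer p) q)).
  have KS q : S_set p q -> exists2 s : prufer p, insubd (0%R : prufer p) q = s & val s = q.
    by move=> /(S_set_ex p_pr)[s <-]; exists s => //; exact: valKd.
  split.
  + move=> q _; have [k qk] := tors (insubd (0%R : prufer p) q); exists k.
    by apply: H90_eq => [|n x]; rewrite ?H90_val1Mn ?H90_val2Mn raddf0//= mul0rn.
  + move=> q1 q2 /KS[s1 -> <-] /KS[s2 -> <-].
    by move/H90_incl_inj ->.
  + move=> m [k mk]; exists (val (val m).1); first exact: S_set_val.
    (* Torsion elements have zero second coordinate, so the first coordinate is the required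
       preimage. *)
    rewrite valKd; apply/esym; apply: (H90_torsion p_pr tors _ mk).
    by rewrite expn_gt0 prime_gt0.
  + move=> q1 q2 /KS[s1 -> <-] /KS[s2 -> <-].
    by rewrite -[S_add _ _]/(val (s1 + s2)%R) valKd H90_inclD.
  + move=> g q /KS[s -> <-].
    by rewrite -val_prufer_act valKd H90_incl_act.
- exact: (H90_H1_trivial p_pr tors divS divc).
Qed.
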